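(* Let $n\ge1$ and let $v=x_1x_2\ldots x_{n-1}$ be a word over $\{0,1\}$. The group $\mathfrak{K}(v)$ has the presentation \[\mathfrak{K}(v)=\Big\langle a_1,\ldots,a_n\,\Big|\,\varphi^\ell(\mathcal R_2)\text{ for all }\ell\ge0\Big\rangle,\] where $\varphi$ is the endomorphism of the free group $F_n$ on $\{a_1,\dots,a_n\}$ given by $\varphi(a_n)=a_1^2$ and, for $1\le i<n$, $\varphi(a_i)=a_{i+1}$ if $x_i=0$ and $\varphi(a_i)=a_1a_{i+1}a_1^{-1}$ if $x_i=1$; and $\mathcal R_2\subset F_n$ is the set \[\mathcal R_2=\Big\{\big[a_i,a_j^{a_1^{2k}}\big]:2\le i,j\le n,\ 0\le2k\le2,\ x_{i-1}\ne x_{j-1}\Big\}\cup\Big\{\big[a_i,a_j^{a_1^{2k+1}}\big]:2\le i,j\le n,\ 0\le2k+1\le2,\ x_{i-1}=x_{j-1}\Big\}.\]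
   Context: $[a,b]=a^{-1}b^{-1}ab$ and $a^b=b^{-1}ab$. Automorphisms of the binary rooted tree $\{0,1\}^*$ act on the right. $\langle\langle g_0,g_1\rangle\rangle$ denotes the automorphism $0u\mapsto0u^{g_0}$, $1u\mapsto1u^{g_1}$; $\sigma$ is the automorphism exchanging $0$ and $1$ in the first letter; $\langle\langle g_0,g_1\rangle\rangle\sigma$ means first apply $\langle\langle g_0,g_1\rangle\rangle$, then $\sigma$. For $v=x_1\ldots x_{n-1}$, $\mathfrak{K}(v)$ is the subgroup of $\mathrm{Aut}(\{0,1\}^* )$ generated by $a_1,\dots,a_n$ defined recursively by $a_1=\langle\langle1,a_n\rangle\rangle\sigma$ and, for $1\le i<n$, $a_{i+1}=\langle\langle a_i,1\rangle\rangle$ if $x_i=0$, $a_{i+1}=\langle\langle1,a_i\rangle\rangle$ if $x_i=1$. The generators $a_i$ of the presentation correspond to the automorphisms of the same name. *)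

(* Defs.v *)
From HB Require Import structures.
From mathcomp Require Import all_boot.
From mathcomp Require Import boolp classical_sets.

Set Implicit Arguments.
Unset Strict Implicit.
Unset Printing Implicit Defensive.

Local Open Scope classical_set_scope.
Local Open Scope group_scope.

Section Subgroups.
Variable G : groupType.
Implicit Types H X : set G.

Definition is_subgroup H : Prop :=
  H 1 /\ forall x y, H x -> H y -> H (x * y^-1).

Definition is_normal_subgroup H : Prop :=
  is_subgroup H /\ forall x y, H x -> H (x ^ y).

Definition generated_subgroup X : set G := smallest is_subgroup X.

Definition normal_closure X : set G := smallest is_normal_subgroup X.

End Subgroups.

Section ReducedWords.
Variable I : choiceType.

(* [(i, false)] stands for the generator [i], [(i, true)] for its inverse. *)
Definition letter := (I * bool)%type.
Definition linv (x : letter) : letter := (x.1, ~~ x.2).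
Definition is_reduced (s : seq letter) := sorted (fun x y => y != linv x) s.

Record free_group := FreeGroup {
  free_word :> seq letter;
  _ : is_reduced free_word
}.

HB.instance Definition _ := [isSub for free_word].
HB.instance Definition _ := [Choice of free_group by <:].

Definition cons_red (x : letter) (s : seq letter) :=
  if s is y :: s' then if y == linv x then s' else x :: s else [:: x].
Definition reduce (s : seq letter) := foldr cons_red [::] s.

Lemma linvK : involutive linv.
Proof. by case=> i b; rewrite /linv /= negbK. Qed.

Lemma cons_red_reduced x s : is_reduced s -> is_reduced (cons_red x s).
Proof.
case: s => [|y s] //= ys; case: ifPn => /= [_|yx]; last by rewrite yx.
by apply: path_sorted ys.
Qed.

Lemma reduce_reduced s : is_reduced (reduce s).
Proof. by elim: s => //= x s /(cons_red_reduced x). Qed.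

Lemma reduce_id s : is_reduced s -> reduce s = s.
Proof.
elim: s => //= x s IHs xs; rewrite IHs; last exact: path_sorted xs.
by case: s xs {IHs} => //= y s /andP[/negPf->].
Qed.

Lemma cons_redK x s : is_reduced s -> cons_red x (cons_red (linv x) s) = s.
Proof.
case: s => [|y s] /=; first by rewrite eqxx.
rewrite linvK; case: eqP => [->|_]; last by rewrite /= eqxx.
by case: s => //= z s /andP[/negPf->].
Qed.

Lemma cons_redKV x s : is_reduced s -> cons_red (linv x) (cons_red x s) = s.
Proof. by move=> /(cons_redK (linv x)); rewrite linvK. Qed.

Lemma foldr_reduce s t : is_reduced t ->
  foldr cons_red t s = foldr cons_red t (reduce s).
Proof.
move=> rt; have rf u : is_reduced (foldr cons_red t u).
  by elim: u => //= x u /(cons_red_reduced x).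
elim: s => //= x s ->; case: (reduce s) => [|y u] //=.
by case: eqP => // -> /=; rewrite cons_redK.
Qed.

Lemma reduce_catl s t : reduce (reduce s ++ t) = reduce (s ++ t).
Proof. by rewrite /reduce !foldr_cat -foldr_reduce // reduce_reduced. Qed.

Lemma reduce_catr s t : reduce (s ++ reduce t) = reduce (s ++ t).
Proof. by rewrite /reduce !foldr_cat -!/(reduce _) reduce_id ?reduce_reduced. Qed.

Lemma reduce_linvl s : reduce (map linv (rev s) ++ s) = [::].
Proof.
elim: s => //= x s IHs; rewrite rev_cons map_rcons cat_rcons -IHs.
rewrite /reduce !foldr_cat /= cons_redKV //; exact: reduce_reduced.
Qed.

Lemma reduce_linvr s : reduce (s ++ map linv (rev s)) = [::].
Proof.
have {2}-> : s = map linv (rev (map linv (rev s))).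
  by rewrite -map_rev revK mapK //; exact: linvK.
by have := reduce_linvl (map linv (rev s)); rewrite -!map_rev !revK !mapK //;
  exact: linvK.
Qed.

Definition free_of_seq s : free_group := FreeGroup (reduce_reduced s).

Definition free_one := free_of_seq [::].
Definition free_mul (u v : free_group) := free_of_seq (u ++ v).
Definition free_inv (u : free_group) := free_of_seq (map linv (rev u)).

Lemma free_wordK (u : free_group) : reduce u = u.
Proof. by case: u => u ru; exact: reduce_id. Qed.

Lemma free_mulA : associative free_mul.
Proof.
by move=> u v w; apply: val_inj; rewrite /= reduce_catr reduce_catl catA.
Qed.
Lemma free_mul1 : left_id free_one free_mul.
Proof. by move=> u; apply: val_inj; rewrite /= free_wordK. Qed.
Lemma free_mulr1 : right_id free_one free_mul.
Proof. by move=> u; apply: val_inj; rewrite /= cats0 free_wordK. Qed.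
Lemma free_mulV : left_inverse free_one free_inv free_mul.
Proof. by move=> u; apply: val_inj; rewrite /= reduce_catl reduce_linvl. Qed.
Lemma free_mulrV : right_inverse free_one free_inv free_mul.
Proof. by move=> u; apply: val_inj; rewrite /= reduce_catr reduce_linvr. Qed.

HB.instance Definition _ := isGroup.Build free_group
  free_mulA free_mul1 free_mulr1 free_mulV free_mulrV.

Definition free_gen (i : I) : free_group := free_of_seq [:: (i, false)].

Section Lift.
Variables (G : groupType) (a : I -> G).

Definition letter_val (x : letter) : G := if x.2 then (a x.1)^-1 else a x.1.

Definition free_lift (w : free_group) : G := \prod_(x <- free_word w) letter_val x.

Lemma letter_val_linv x : letter_val (linv x) = (letter_val x)^-1.
Proof. by case: x => i []; rewrite /letter_val /= ?invgK. Qed.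

Lemma prod_reduce s :
  \prod_(x <- reduce s) letter_val x = \prod_(x <- s) letter_val x.
Proof.
elim: s => //= x s IHs; rewrite big_cons -IHs.
case: (reduce s) => [|y u] /=; first by rewrite big_cons.
case: eqP => [->|_]; rewrite !big_cons //.
by rewrite letter_val_linv mulVKg.
Qed.

Lemma free_liftM : {morph free_lift : u v / u * v}.
Proof. by move=> u v; rewrite /free_lift prod_reduce big_cat. Qed.

Lemma free_lift1 : free_lift 1 = 1.
Proof. by rewrite /free_lift big_nil. Qed.

HB.instance Definition _ := isUMagmaMorphism.Build free_group G free_lift
  (free_lift1, free_liftM).

Lemma free_lift_gen i : free_lift (free_gen i) = a i.
Proof. by rewrite /free_lift big_seq1. Qed.

End Lift.
End ReducedWords.

(* [K] has the presentation [< a_i, i in I | R >], the generator [i] of the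
    free group corresponding to the element [a i] of [G]. *)
Definition has_presentation (G : groupType) (K : set G) (I : choiceType)
    (a : I -> G) (R : set (free_group I)) : Prop :=
  range (free_lift a) = K /\
  [set w | free_lift a w = 1] = normal_closure R.

(* The root is the empty word; the letters 0 and 1 are [false] and [true]. *)
Definition vertex := seq bool.
Definition adjacent (u w : vertex) : bool :=
  [exists x, w == rcons u x] || [exists x, u == rcons w x].

Record tree_aut := TreeAut {
  taut_fun :> vertex -> vertex;
  taut_inv : vertex -> vertex;
  taut_funK : cancel taut_fun taut_inv;
  taut_invK : cancel taut_inv taut_fun;
  taut_root : taut_fun [::] = [::];
  taut_adj : forall u w, adjacent (taut_fun u) (taut_fun w) = adjacent u w
}.

Lemma tree_autP (g h : tree_aut) : g =1 h -> g = h.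
Proof.
case: g h => [f f' fK f'K fr fa] [h h' hK h'K hr ha] /= /funext efh.
subst h; have e' : f' = h' by apply/funext => u; rewrite -{1}(h'K u) fK.
by subst h'; congr TreeAut; exact: Prop_irrelevance.
Qed.

HB.instance Definition _ := gen_eqMixin tree_aut.
HB.instance Definition _ := gen_choiceMixin tree_aut.

Definition taut_one : tree_aut.
Proof. by exists id id. Defined.

Definition taut_V (g : tree_aut) : tree_aut.
Proof.
exists (taut_inv g) g; [exact: taut_invK | exact: taut_funK | |].
- by rewrite -{1}(taut_root g) taut_funK.
- by move=> u w; rewrite -(taut_adj g) !taut_invK.
Defined.

(* Automorphisms act on the right: in a product, the left factor acts first. *)
Definition taut_mul (g h : tree_aut) : tree_aut.
Proof.
exists (h \o g) (taut_inv g \o taut_inv h) => /=.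
- exact: can_comp (taut_funK h) (taut_funK g).
- exact: can_comp (taut_invK g) (taut_invK h).
- by rewrite !taut_root.
- by move=> u w; rewrite !taut_adj.
Defined.

Lemma taut_mulA : associative taut_mul.
Proof. by move=> f g h; exact: tree_autP. Qed.
Lemma taut_mul1 : left_id taut_one taut_mul.
Proof. by move=> g; exact: tree_autP. Qed.
Lemma taut_mulr1 : right_id taut_one taut_mul.
Proof. by move=> g; exact: tree_autP. Qed.
Lemma taut_mulV : left_inverse taut_one taut_V taut_mul.
Proof. by move=> g; apply: tree_autP => u /=; rewrite taut_invK. Qed.
Lemma taut_mulrV : right_inverse taut_one taut_V taut_mul.
Proof. by move=> g; apply: tree_autP => u /=; rewrite taut_funK. Qed.

HB.instance Definition _ := isGroup.Build tree_aut
  taut_mulA taut_mul1 taut_mulr1 taut_mulV taut_mulrV.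

Lemma adjacent_cons x y u w :
  adjacent (x :: u) (y :: w) = (x == y) && adjacent u w.
Proof.
rewrite /adjacent; apply/orP/andP => [[]/existsP[z]|[/eqP-> /orP[]/existsP[z]]].
- rewrite rcons_cons => /eqP[-> ->]; split=> //.
  by apply/orP; left; apply/existsP; exists z.
- rewrite rcons_cons => /eqP[-> ->]; split=> //.
  by apply/orP; right; apply/existsP; exists z.
- by move=> /eqP->; left; apply/existsP; exists z; rewrite rcons_cons.
- by move=> /eqP->; right; apply/existsP; exists z; rewrite rcons_cons.
Qed.

Lemma adjacentC u w : adjacent u w = adjacent w u.
Proof. by rewrite /adjacent orbC. Qed.

Lemma adjacent_nil x u : adjacent [::] (x :: u) = (u == [::]).
Proof.
rewrite /adjacent; apply/orP/eqP => [[]/existsP[z]|->].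
- by rewrite /= => /eqP[].
- by rewrite rcons_cons.
- by left; apply/existsP; exists x.
Qed.

Lemma taut_eq_root (g : tree_aut) u : (g u == [::]) = (u == [::]).
Proof. by rewrite -{1}(taut_root g) (can_eq (taut_funK g)). Qed.

Section PairAut.
Variables g0 g1 : tree_aut.

Definition pair_fun (u : vertex) : vertex :=
  if u is x :: u' then x :: (if x then g1 u' else g0 u') else [::].
Definition pair_inv (u : vertex) : vertex :=
  if u is x :: u' then x :: (if x then g1^-1 u' else g0^-1 u') else [::].

Lemma pair_funK : cancel pair_fun pair_inv.
Proof. by case=> [|[] u] //=; rewrite taut_funK. Qed.
Lemma pair_invK : cancel pair_inv pair_fun.
Proof. by case=> [|[] u] //=; rewrite taut_invK. Qed.
Lemma pair_adj u w : adjacent (pair_fun u) (pair_fun w) = adjacent u w.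
Proof.
case: u w => [|x u] [|y w] //=.
- by rewrite !adjacent_nil; case: y; rewrite taut_eq_root.
- by rewrite ![adjacent _ [::]]adjacentC !adjacent_nil; case: x;
    rewrite taut_eq_root.
- by rewrite !adjacent_cons; case: eqP => // <- /=; case: x; rewrite taut_adj.
Qed.

Definition pair_aut : tree_aut :=
  TreeAut pair_funK pair_invK erefl pair_adj.

End PairAut.

Definition flip_fun (u : vertex) : vertex :=
  if u is x :: u' then ~~ x :: u' else [::].

Lemma flip_funK : involutive flip_fun.
Proof. by case=> //= x u; rewrite negbK. Qed.
Lemma flip_adj u w : adjacent (flip_fun u) (flip_fun w) = adjacent u w.
Proof.
case: u w => [|x u] [|y w] //=; rewrite ?adjacent_nil //.
- by rewrite ![adjacent _ [::]]adjacentC !adjacent_nil.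
- by rewrite !adjacent_cons (inj_eq negb_inj).
Qed.

Definition flip_aut : tree_aut :=
  TreeAut flip_funK flip_funK erefl flip_adj.

(* A word [v = x_1 ... x_(n-1)] is an [m]-tuple with [n = m.+1], and the
   generator [a_k], [1 <= k <= n], is indexed by [k - 1 : 'I_m.+1]. For
   [i : 'I_m], standing for the position [k = i + 1] in [v], [x_k] is
   [tnth v i], [a_k] is indexed by [lift ord_max i], whose value is [i], and
   [a_(k+1)] by [lift ord0 i], whose value is [i + 1]. *)

Section Kneading.
Variables (m : nat) (v : m.-tuple bool).

Definition kneading_recursion (a : 'I_m.+1 -> tree_aut) : Prop :=
  a ord0 = pair_aut 1 (a ord_max) * flip_aut /\
  forall i : 'I_m, a (lift ord0 i) =
    if tnth v i then pair_aut 1 (a (lift ord_max i))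
    else pair_aut (a (lift ord_max i)) 1.

Fixpoint kneading_fun (k : 'I_m.+1) (u : vertex) : vertex :=
  if u is x :: u' then
    if unlift ord0 k is Some i then
      x :: (if x == tnth v i then kneading_fun (lift ord_max i) u' else u')
    else ~~ x :: (if x then kneading_fun ord_max u' else u')
  else [::].

Fixpoint kneading_inv (k : 'I_m.+1) (u : vertex) : vertex :=
  if u is x :: u' then
    if unlift ord0 k is Some i then
      x :: (if x == tnth v i then kneading_inv (lift ord_max i) u' else u')
    else ~~ x :: (if x then u' else kneading_inv ord_max u')
  else [::].

Lemma kneading_funK k : cancel (kneading_fun k) (kneading_inv k).
Proof.
move=> u; elim: u k => //= x u IHu k.
case: unliftP => [i|] -> /=; last by rewrite unlift_none; case: x; rewrite /= ?IHu.
by rewrite liftK; case: eqP; rewrite ?IHu.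
Qed.

Lemma kneading_invK k : cancel (kneading_inv k) (kneading_fun k).
Proof.
move=> u; elim: u k => //= x u IHu k.
case: unliftP => [i|] -> /=; last by rewrite unlift_none; case: x; rewrite /= ?IHu.
by rewrite liftK; case: eqP; rewrite ?IHu.
Qed.

Lemma kneading_eq_root k u : (kneading_fun k u == [::]) = (u == [::]).
Proof. by case: u => //= x u; case: unlift. Qed.

Lemma kneading_adj k u w :
  adjacent (kneading_fun k u) (kneading_fun k w) = adjacent u w.
Proof.
elim: u w k => [|x u IHu] [|y w] k //=.
- case: unlift => [i|]; rewrite !adjacent_nil; case: ifP => //;
    by rewrite kneading_eq_root.
- rewrite ![adjacent _ [::]]adjacentC.
  case: unlift => [i|]; rewrite !adjacent_nil; case: ifP => //;
    by rewrite kneading_eq_root.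
- case: unlift => [i|]; rewrite !adjacent_cons ?(inj_eq negb_inj);
    by case: eqP => // <- /=; case: ifP.
Qed.

Definition kneading_gen (k : 'I_m.+1) : tree_aut :=
  TreeAut (kneading_funK k) (kneading_invK k) erefl (kneading_adj k).

Lemma kneading_genP : kneading_recursion kneading_gen.
Proof.
split=> [|i].
  by apply: tree_autP; case=> [|[] u] //=; rewrite unlift_none.
by apply: tree_autP => u; case: ifP => vi; case: u => [|[] u] //=;
  rewrite liftK vi.
Qed.

Lemma kneading_recursion_uniq a : kneading_recursion a -> a = kneading_gen.
Proof.
move=> [a0 aS]; apply/funext => k; apply: tree_autP => u.
elim: u k => [|x u IHu] k; first exact: taut_root.
rewrite [RHS]/=; case: unliftP => [i|] ->.
  by rewrite aS; case: (tnth v i); case: x; rewrite //= IHu.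
by rewrite a0; case: x; rewrite //= IHu.
Qed.

Definition kneading_group : set tree_aut :=
  generated_subgroup (range kneading_gen).

Local Notation F := (free_group 'I_m.+1).
Local Notation x1 := (free_gen (ord0 : 'I_m.+1)).

Definition kneading_endo_gen (k : 'I_m.+1) : F :=
  if unlift ord_max k is Some i then
    if tnth v i then x1 * free_gen (lift ord0 i) * x1^-1
    else free_gen (lift ord0 i)
  else x1 ^+ 2.

Definition kneading_endo : F -> F := free_lift kneading_endo_gen.

(* As [i] and [j] run through ['I_m], [lift ord0 i] and
   [lift ord0 j] run through the generators [a_2], ..., [a_n]. *)
Definition kneading_relators : set F :=
  [set r | exists i j : 'I_m, exists2 k : nat,
     (2 * k <= 2)%N /\ tnth v i <> tnth v j &
     r = [~ free_gen (lift ord0 i),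
            free_gen (lift ord0 j) ^ (x1 ^+ (2 * k)%N)]] `|`
  [set r | exists i j : 'I_m, exists2 k : nat,
     (2 * k + 1 <= 2)%N /\ tnth v i = tnth v j &
     r = [~ free_gen (lift ord0 i),
            free_gen (lift ord0 j) ^ (x1 ^+ (2 * k + 1)%N)]].

End Kneading.

(* Main.v *)
Require Import Defs.
From HB Require Import structures.
From mathcomp Require Import all_boot generic_quotient.
From mathcomp Require Import boolp classical_sets.

Set Implicit Arguments.
Unset Strict Implicit.
Unset Printing Implicit Defensive.

Local Open Scope classical_set_scope.
Local Open Scope quotient_scope.
Local Open Scope group_scope.

(** Write [psi] for the wreath recursion, which sends a word fixing the first
    letter to the pair of its sections at [0] and [1], and write
    [L_i = phi a_i] for [i < n] and [t = a_1 ^+ 2 = phi a_n]. Since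
    [psi (L_i) = (a_i, 1)] and [psi t = (a_n, a_n)], the endomorphism [phi] is
    almost a right inverse of [psi]: [psi (phi w) = (w, a_n ^ k)], where [k]
    is the exponent sum of [a_n] in [w].

    Each element of [R_2] acts trivially on the tree, as the commutator of two
    automorphisms supported on different halves of it ([relator_trivial]). So
    do its images under the powers of [phi]: they are commutators, and the
    exponent sum [k] vanishes on commutators ([kills_relators_gen]).

    For the converse, let [b] be any tuple of elements of a group [Q] that
    satisfies the relators. Two facts show that every word acting trivially
    on the tree evaluates to [1] at [b].

    First, the kernel of [psi] consists of consequences of the relators. It is
    the normal closure of the commutators of the [L_i ^ (t ^ k)] with the
    [L_j ^ a_1], for all integers [k]. Only the cases [k = 0] and [k = 1] come from [R_2]
    itself; the others follow from [phi R_2], which contains relations between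
    [t] and the [L_i] forcing each [L_i ^ (t ^ k)] into the subgroup generated
    by the [L_j] and [L_1 ^ t] ([left_conj_cyclic]). The value of a word [w]
    with sections [w0] and [w1] then has the normal form
    [phi w0 * t ^ (-k) * (phi w1 * t ^ (-k1)) ^ a_1 * (t ^ k * a_1 ^ o)], where
    [k] and [k1] are the exponent sums of [a_n] in [w0] and [w1], and [o] is
    [0] or [1] according to the action of [w] on the first letter
    ([word_val_sections]). The maps [b \o phi] and [a_n |-> t, a_i |-> 1]
    satisfy the relators as well, so if [w0] and [w1] evaluate to [1] at all
    tuples satisfying the relators, then so does [w].

    Second, sections of words acting trivially end up shorter. The sizes of
    [w0] and [w1] add up to the size of [w], so in a counterexample of minimal
    size one section has full size, and it is again a minimal counterexample,
    equal to [w] with all its letters shifted. Iterating, every shift of [w]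
    follows a path on which each letter contributes. Recording the position
    of all these paths at once turns [w] into a closed walk in a cube
    [{0,1}^n] that uses, for each generator, a single edge, the edges of
    different generators having different directions. Such edges form a
    forest, so the walk backtracks ([closed_walk_backtracks]): [w] contains a
    letter followed by its inverse, and is not minimal. *)

(** * Generated subgroups and quotients *)

Section Subgroups.
Variable G : groupType.
Implicit Types X H : set G.

Lemma generated_subgroupP X : is_subgroup (generated_subgroup X).
Proof.
split=> [H [[H1 _] _] // | x y Xx Xy H [sH sXH]].
by apply: sH.2; [apply: Xx | apply: Xy].
Qed.

Lemma normal_closureP X : is_normal_subgroup (normal_closure X).
Proof.
split; first split=> [H [[[H1 _] _] _] // | x y Xx Xy H [nH sXH]].
  by apply: nH.1.2; [apply: Xx | apply: Xy].
by move=> x y Xx H [nH sXH]; apply: nH.2; apply: Xx.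
Qed.

Lemma subgroupV H x : is_subgroup H -> H x -> H x^-1.
Proof. by move=> [H1 HF] Hx; rewrite -[x^-1]mul1g; exact: HF. Qed.

Lemma subgroupM H x y : is_subgroup H -> H x -> H y -> H (x * y).
Proof.
by move=> sH Hx Hy; rewrite -[y]invgK; apply: sH.2 => //; exact: subgroupV.
Qed.

Lemma subgroup_prod (I : Type) (s : seq I) (P : pred I) (F : I -> G) H :
    is_subgroup H -> (forall i, P i -> H (F i)) ->
  H (\prod_(i <- s | P i) F i).
Proof.
move=> sH HF; elim/big_ind: _ => //; first exact: sH.1.
by move=> x y; apply: subgroupM.
Qed.

End Subgroups.

Section Conjugation.
Variable G : groupType.
Implicit Types (x y z p t : G) (H : set G).

Lemma commuteJ x y z : commute (x ^ z) (y ^ z) <-> commute x y.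
Proof. by rewrite /commute -!conjMg; split=> [/conjg_inj|->]. Qed.

(** This and the next identity push a letter [a_1] or its inverse through the
    normal form of [word_val_sections]. *)
Lemma mulg_conj x y z t : t * (x * y ^ t * z) = x ^ t^-1 * y * (t * z).
Proof. by rewrite !conjgE invgK !mulgA. Qed.

Lemma mulVg_conj x y z t :
  t^-1 * (x * y ^ t * z) = x ^ t * y ^ (t ^+ 2) * (t^-1 * z).
Proof. by rewrite expg2 conjgM !conjgE !mulgA !mulgK. Qed.

Lemma centralizerP (J : Type) (f : J -> G) :
  is_subgroup [set x | forall j, commute x (f j)].
Proof.
split=> [j|x y Hx Hy j]; first exact/commute_sym/commute1.
by apply/commute_sym/commuteM/commuteV/commute_sym; [exact/commute_sym|].
Qed.

Lemma commute_cyclic t x z :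
  generated_subgroup [set t] z -> commute x t -> commute x z.
Proof.
move=> tz xt; apply/commute_sym.
apply: (tz [set z | forall j : unit, commute z x] _ tt); split.
  exact: centralizerP.
by move=> _ -> _; exact/commute_sym.
Qed.

(** If [t] commutes with [t ^ p], it commutes with [e = p^-1 * p ^ t], so that
    conjugating [p] by [t] repeatedly just multiplies it by powers of [e]: the
    conjugates of [p] by all powers of [t] lie in the subgroup generated by
    [p] and [p ^ t]. *)
Lemma conj_cyclic H p t z : is_subgroup H -> H p -> H (p ^ t) ->
  commute t (t ^ p) -> generated_subgroup [set t] z -> H (p ^ z).
Proof.
move=> sH Hp Hpt tp tz.
suff [e [He [_ ->]]] : exists e, H e /\ commute e t /\ p ^ z = p * e.
  exact: subgroupM.
pose S := [set z | (forall x, commute x t -> commute x z) /\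
                   exists e, H e /\ commute e t /\ p ^ z = p * e].
suff /(tz S)[] : is_subgroup S /\ [set t] `<=` S by [].
split=> [|_ ->].
  split=> [|x y [xC [e [He [et pe]]]] [yC [f [Hf [ft pf]]]]].
    split=> [x _|]; first exact: commute1.
    by exists 1; rewrite conjg1 mulg1; split; [exact: sH.1|split=> //];
      exact/commute_sym/commute1.
  split=> [u ut|].
    by apply: commuteM; [exact: xC | apply: commuteV; exact: yC].
  exists (f^-1 * e); split; first by apply: subgroupM => //; exact: subgroupV.
  split; first by apply/commute_sym/commuteM; first apply: commuteV;
    exact/commute_sym.
  have fy : f ^ y^-1 = f by apply/conjg_fixP/commgP/commuteV/yC.
  have ey : e ^ y^-1 = e by apply/conjg_fixP/commgP/commuteV/yC.
  rewrite conjgM pe conjMg ey mulgA; congr (_ * _).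
  by apply: (mulIg f); rewrite mulgVK -{1}fy -conjMg -pf conjgK.
(* The witness also equals (t^-1)^p * t, so it commutes with t. *)
split=> //; exists (p^-1 * p ^ t); split.
  by apply: subgroupM => //; exact: subgroupV.
split; last by rewrite mulVKg.
rewrite -[_ * _]/(p^-1 * (t^-1 * (p * t)))
  -[X in commute X _](_ : t^-1 ^ p * t = _).
  by apply/commute_sym/commuteM => //; rewrite conjVg; exact: commuteV.
by rewrite conjgE -!mulgA.
Qed.

(** Since [z] fixes [x ^ y], it sends [x = (x ^ y) ^ y^-1] to
    [(x ^ y) ^ (y ^ z)^-1], which only involves [x], [y] and [y ^ z]. *)
Lemma conj_twisted H x y z : is_subgroup H -> H x -> H y -> H (y ^ z) ->
  commute (x ^ y) z -> H (x ^ z).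
Proof.
move=> sH Hx Hy Hyz /commgP/conjg_fixP xyz.
have -> : x ^ z = (x ^ y) ^ (y ^ z)^-1.
  by rewrite -[in LHS](conjgK y x) conjJg conjVg xyz.
rewrite conjgE invgK; do ?apply: subgroupM => //; exact: subgroupV.
Qed.

End Conjugation.

Section Quotient.
Variables (G : groupType) (N : set G) (nN : is_normal_subgroup N).

Definition coset_rel (x y : G) := `[< N (x * y^-1) >].

Lemma coset_rel_refl : reflexive coset_rel.
Proof. by move=> x; apply/asboolP; rewrite mulgV; exact: nN.1.1. Qed.

Lemma coset_rel_sym : symmetric coset_rel.
Proof.
by move=> x y; apply/asboolP/asboolP => /(subgroupV nN.1); rewrite invgF.
Qed.

Lemma coset_rel_trans : transitive coset_rel.
Proof.
move=> y x z /asboolP Nxy /asboolP Nyz; apply/asboolP.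
by rewrite -(divgKA y); exact: subgroupM nN.1 _ _.
Qed.

Canonical coset_equiv :=
  EquivRel coset_rel coset_rel_refl coset_rel_sym coset_rel_trans.

Definition quotient_group := {eq_quot coset_equiv}%qT.
HB.instance Definition _ := Choice.on quotient_group.

Definition quotient_pi (x : G) : quotient_group := \pi_quotient_group%qT x.
Definition quotient_repr (a : quotient_group) : G := repr a.

Lemma quotient_eqP x y : quotient_pi x = quotient_pi y <-> N (x * y^-1).
Proof.
by split=> [/eqmodP/asboolP | Nxy] //; apply/eqmodP/asboolP.
Qed.

Lemma quotient_reprK a : quotient_pi (quotient_repr a) = a.
Proof. exact: reprK. Qed.

Definition quotient_mul a b := quotient_pi (quotient_repr a * quotient_repr b).
Definition quotient_inv a := quotient_pi (quotient_repr a)^-1.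

Lemma quotient_piM x y :
  quotient_pi (x * y) = quotient_mul (quotient_pi x) (quotient_pi y).
Proof.
have Nr z : N (z * (quotient_repr (quotient_pi z))^-1).
  by apply/quotient_eqP; rewrite quotient_reprK.
apply/quotient_eqP; set x' := quotient_repr _; set y' := quotient_repr _.
have -> : x * y / (x' * y') = (y / y') ^ x^-1 * (x / x').
  by rewrite conjgE invgM invgK -!mulgA mulKg.
by apply: subgroupM nN.1 _ (Nr x); apply: nN.2; apply: Nr.
Qed.

Lemma quotient_piV x : quotient_pi x^-1 = quotient_inv (quotient_pi x).
Proof.
apply/quotient_eqP; set x' := quotient_repr _; rewrite invgK.
have -> : x^-1 * x' = ((x / x')^-1) ^ x by rewrite conjgE invgF mulgVK.
apply: nN.2; apply: subgroupV nN.1 _; apply/quotient_eqP.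
by rewrite quotient_reprK.
Qed.

Lemma quotient_mulA : associative quotient_mul.
Proof.
move=> a b c; rewrite -(quotient_reprK a) -(quotient_reprK b).
by rewrite -(quotient_reprK c) -!quotient_piM mulgA.
Qed.
Lemma quotient_mul1 : left_id (quotient_pi 1) quotient_mul.
Proof. by move=> a; rewrite -(quotient_reprK a) -quotient_piM mul1g. Qed.
Lemma quotient_mulr1 : right_id (quotient_pi 1) quotient_mul.
Proof. by move=> a; rewrite -(quotient_reprK a) -quotient_piM mulg1. Qed.
Lemma quotient_mulV : left_inverse (quotient_pi 1) quotient_inv quotient_mul.
Proof.
by move=> a; rewrite -(quotient_reprK a) -quotient_piV -quotient_piM mulVg.
Qed.
Lemma quotient_mulrV : right_inverse (quotient_pi 1) quotient_inv quotient_mul.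
Proof.
by move=> a; rewrite -(quotient_reprK a) -quotient_piV -quotient_piM mulgV.
Qed.

HB.instance Definition _ := isGroup.Build quotient_group
  quotient_mulA quotient_mul1 quotient_mulr1 quotient_mulV quotient_mulrV.

HB.instance Definition _ := isUMagmaMorphism.Build G quotient_group quotient_pi
  (erefl, quotient_piM).

Lemma quotient_pi_eq1 x : quotient_pi x = 1 <-> N x.
Proof. by rewrite -{2}(divg1 x); exact: quotient_eqP. Qed.

End Quotient.

(** * Evaluation of words *)

Section Words.
Variable I : choiceType.
Implicit Types (G H : groupType) (s t : seq (letter I)).

Definition word_val G (a : I -> G) s := \prod_(x <- s) letter_val a x.

Lemma word_val_cons G (a : I -> G) x s :
  word_val a (x :: s) = letter_val a x * word_val a s.
Proof. by rewrite /word_val big_cons. Qed.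

Lemma word_val_cat G (a : I -> G) s t :
  word_val a (s ++ t) = word_val a s * word_val a t.
Proof. by rewrite /word_val big_cat. Qed.

Lemma free_lift_comp G H (h : UMagmaMorphism.type G H) (a : I -> G) w :
  free_lift (h \o a) w = h (free_lift a w).
Proof.
rewrite /free_lift gmulf_prod; apply: eq_bigr => -[i []] _ //.
by rewrite /letter_val gmulfV.
Qed.

Lemma free_of_seq_cons x s :
  free_of_seq (x :: s) = letter_val (@free_gen I) x * free_of_seq s.
Proof.
apply: val_inj; case: x => i [] /=;
  by rewrite [reduce (reduce s)]reduce_id ?reduce_reduced.
Qed.

Lemma free_lift_id (w : free_group I) : free_lift (@free_gen I) w = w.
Proof.
have {2}-> : w = free_of_seq w by apply/val_inj/esym/free_wordK.
rewrite /free_lift; elim: (free_word w) => [|x s IHs].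
  by rewrite big_nil.
by rewrite big_cons IHs free_of_seq_cons.
Qed.

Lemma commute_word_val G (a : I -> G) z s :
  (forall i, commute z (a i)) -> commute z (word_val a s).
Proof.
move=> za; apply: commute_prod => -[i []] _; rewrite /letter_val //=.
exact: commuteV.
Qed.

Lemma free_lift_commg_abelian G (a : I -> G) (x y : free_group I) :
  (forall i j, commute (a i) (a j)) -> free_lift a [~ x, y] = 1.
Proof.
move=> aC; rewrite gmulfR; apply/eqP/commgP.
apply/commute_sym/commute_word_val => i.
apply/commute_sym/commute_word_val => j.
exact: aC.
Qed.

End Words.

(** * Sections of words and their length *)

Section Sections.
Variables (m : nat) (v : m.-tuple bool).
Local Notation I := ('I_m.+1).
Local Notation a := (kneading_gen v).
Implicit Types (c d : letter I) (w u : seq (letter I)) (x y : bool).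

Definition shift (i : I) : I :=
  if unlift ord0 i is Some j then lift ord_max j else ord_max.

Definition shift_letter c : letter I := (shift c.1, c.2).

(** The one first letter at which [c] has a nontrivial section: [1] for [a_1]
    and hence [0] for its inverse. The section there is [c] with its index
    decreased by one, cyclically. *)
Definition side_in c : bool :=
  if unlift ord0 c.1 is Some j then tnth v j else ~~ c.2.

Definition move x c : bool := (c.1 == ord0) (+) x.

Fixpoint section x w : seq (letter I) :=
  if w is c :: w' then
    let s := section (move x c) w' in
    if x == side_in c then shift_letter c :: s else s
  else [::].

Definition endpoint x w : bool := foldl move x w.

Lemma endpointN x w : endpoint (~~ x) w = ~~ endpoint x w.
Proof. by elim: w x => //= c w IHw x; rewrite /move addbN IHw. Qed.

Lemma act_letter c x (u : vertex) :
  letter_val a c (x :: u) =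
    move x c :: (if x == side_in c then letter_val a (shift_letter c) u else u).
Proof.
case: c => i e; rewrite /letter_val /side_in /shift_letter /move /shift /=.
by case: e => /=; case: unliftP => [j|] -> //=; case: x.
Qed.

(** [section x w] is a word for the restriction of [w] to the subtree below
    [x], identified with the whole tree. *)
Lemma act_word w x (u : vertex) :
  word_val a w (x :: u) = endpoint x w :: word_val a (section x w) u.
Proof.
elim: w x u => [|c w IHw] x u; first by rewrite /word_val !big_nil.
rewrite word_val_cons [LHS]/= act_letter IHw /=.
by case: ifP => // _; rewrite word_val_cons.
Qed.

Lemma act_trivial w x :
  word_val a w = 1 -> endpoint x w = x /\ word_val a (section x w) = 1.
Proof.
move=> w1; have E (u : vertex) := act_word w x u; rewrite w1 /= in E.
by split=> [|]; [case: (E [::]) | apply: tree_autP => u; case: (E u)].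
Qed.

(** At each letter of [w] the paths starting from [0] and from [1] are on
    different sides, so the letter contributes to exactly one section. *)
Lemma size_sections w :
  size (section false w) + size (section true w) = size w.
Proof.
elim: w => //= c w IHw.
rewrite /move; case: (c.1 == ord0); case: (side_in c) => /=;
  by rewrite -IHw ?addnS ?addSn // addnC.
Qed.

(** [walk x w y] holds when the path of [x] under [w] ends at [y] and each
    letter of [w] contributes to the section at [x]. *)
Fixpoint walk x w y : bool :=
  if w is c :: w' then (x == side_in c) && walk (move x c) w' y else x == y.

Lemma walk_cons x c w y :
  walk x (c :: w) y = (x == side_in c) && walk (move x c) w y.
Proof. by []. Qed.

Lemma walk_cat x w1 w2 y :
  walk x (w1 ++ w2) y = walk x w1 (endpoint x w1) && walk (endpoint x w1) w2 y.
Proof.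
by elim: w1 x => [|c w1 IHw] x /=; rewrite ?eqxx // IHw -andbA.
Qed.

Lemma walk_endpoint x w y : walk x w y -> y = endpoint x w.
Proof. by elim: w x => /= [x /eqP|c w IHw x /andP[_ /IHw]]. Qed.

Lemma endpoint_noflip x w :
  ~~ has (fun c => c.1 == ord0) w -> endpoint x w = x.
Proof.
by elim: w => //= c w IHw /norP[/negPf c0 /IHw]; rewrite /move c0.
Qed.

Lemma size_section x w : size (section x w) <= size w.
Proof.
by rewrite -(size_sections w); case: x; [exact: leq_addl | exact: leq_addr].
Qed.

Lemma section_full x w : size (section x w) = size w ->
  walk x w (endpoint x w) /\ section x w = map shift_letter w.
Proof.
elim: w x => [|c w IHw] x /=; first by rewrite eqxx.
case: eqP => _ /=; first by move=> [/IHw[-> ->]].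
by move=> E; have := size_section (move x c) w; rewrite E ltnn.
Qed.

Lemma side_in_linv c : side_in (linv c) = move (side_in c) c.
Proof.
case: c => i e; rewrite /side_in /move /linv /=.
by case: unliftP => [j|] -> /=; case: e.
Qed.

Lemma iter_shift_letter k c :
  iter k shift_letter c = (iter k shift c.1, c.2).
Proof. by elim: k => [|k /= ->] //; case: c. Qed.

Lemma iter_shift_linv k c :
  iter k shift_letter (linv c) = linv (iter k shift_letter c).
Proof. by rewrite !iter_shift_letter. Qed.

Lemma shift_inj : injective shift.
Proof.
move=> i j; rewrite /shift.
case: (unliftP ord0 i) => [i'|] ->; case: (unliftP ord0 j) => [j'|] ->;
  rewrite ?liftK ?unlift_none //.
- by move=> /lift_inj->.
- by move=> /eqP; rewrite lift_eqF.
- by move=> /eqP; rewrite eq_liftF.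
Qed.

(** For each generator there is thus a level at which it becomes [a_1], the
    only generator moving the first letter; by injectivity of the shift it is
    alone in doing so at that level. *)
Lemma iter_shift_ord0 (i : I) : iter i shift i = ord0.
Proof.
suff E k (j : I) : j = k :> nat -> iter k shift j = ord0 by exact: E.
elim: k j => [|k IHk] j jk; first exact/val_inj.
rewrite iterSr; apply: IHk; rewrite /shift.
case: (unliftP ord0 j) jk => [j'|] -> //.
by rewrite lift_max lift0 => -[].
Qed.

(** The hypothesis says that the positions at all levels [k] together make [w]
    a closed walk. Let [c] be its first letter, and consider the level at
    which the index of [c] becomes [a_1]. There the position changed by [c]
    must be restored, and only letters of the index of [c] can do so; the
    first of them has to be traversed in the opposite direction, so it is
    [linv c]. The part of [w] strictly between them starts and ends, at every
    level, at the endpoint of [c]; it is a shorter closed walk, and if it is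
    empty then [c] and [linv c] are adjacent. *)
Lemma closed_walk_backtracks w : w != [::] ->
    (forall k, exists x, walk x (map (iter k shift_letter) w) x) ->
  exists w1 c w2, w = w1 ++ c :: linv c :: w2.
Proof.
have [n le_n] := ubnP (size w); elim: n => // n IHn in w le_n *.
case: w le_n => // c w le_n _ cl.
have [x] := cl c.1; set f := iter _ _ => /=.
have f0 d : ((f d).1 == ord0) = (d.1 == c.1).
  have shI k : injective (iter k shift).
    by elim: k => //= k IHk; apply: inj_comp shift_inj IHk.
  by rewrite /f iter_shift_letter -(iter_shift_ord0 c.1) (inj_eq (shI _)).
have f_in d : d.1 == c.1 -> side_in (f d) = ~~ d.2.
  by rewrite -f0 => /eqP fd; rewrite /side_in fd unlift_none /f iter_shift_letter.
rewrite f_in // {1}/move f0 eqxx => /andP[/eqP-> /=]; rewrite negbK.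
have nof u : ~~ has (fun d => d.1 == c.1) u ->
    ~~ has (fun d : letter I => d.1 == ord0) (map f u).
  by rewrite has_map; congr (~~ _); apply: eq_has => d /=; rewrite f0.
have [hd|/nof/endpoint_noflip E] := boolP (has (fun d => d.1 == c.1) w);
  last first.
  (* Without a further letter of this index the walk could not close up. *)
  by move/walk_endpoint; rewrite E; case: c.2.
case: (split_find hd) cl le_n => d u u' dc /nof/endpoint_noflip uc {hd} cl le_n.
rewrite cat_rcons map_cat walk_cat uc /= f_in // => /and3P[_ /eqP c2 _].
have {dc c2} dE : d = linv c by rewrite /linv c2 negbK -(eqP dc) -surjective_pairing.
rewrite {d}dE in cl le_n *.
case: u cl le_n {uc} => [|d u] cl le_n; first by exists [::], c, u'.
have [||w1 [e [w2 uE]]] := IHn (d :: u) _ isT.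
- rewrite -ltnS; apply: leq_trans le_n.
  by rewrite /= size_cat size_rcons !ltnS addSnnS leq_addr.
- move=> k; have [y] := cl k; rewrite map_cons cat_rcons map_cat.
  rewrite walk_cons walk_cat => /and3P[/eqP-> h /andP[/eqP h' _]].
  exists (move (side_in (iter k shift_letter c)) (iter k shift_letter c)).
  by move: h; rewrite h' iter_shift_linv side_in_linv.
- by exists (c :: w1), e, (w2 ++ linv c :: u'); rewrite uE -!catA.
Qed.

End Sections.

Arguments shift_letter {m} c.

(** * Consequences of the relators *)

Section Relations.
Variables (m : nat) (v : m.-tuple bool).
Local Notation I := ('I_m.+1).
Local Notation phi := (kneading_endo v).

Lemma iter_kneading_endoR l x y :
  iter l phi [~ x, y] = [~ iter l phi x, iter l phi y].
Proof. by elim: l => //= l ->; rewrite /kneading_endo gmulfR. Qed.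

Lemma relator_is_commutator r : kneading_relators v r ->
  exists x y, r = [~ x, y].
Proof. by case=> -[i [j [k _ ->]]]; do 2 eexists. Qed.

Definition kills_relators (Q : groupType) (b : I -> Q) : Prop :=
  forall l r, kneading_relators v r -> free_lift b (iter l phi r) = 1.

Definition endo_val (Q : groupType) (b : I -> Q) : I -> Q :=
  free_lift b \o kneading_endo_gen v.

(** At [w], the lift of [last_val g] is [g] to the exponent sum of [a_n]
    in [w]. *)
Definition last_val (Q : groupType) (g : Q) (i : I) : Q :=
  if i == ord_max then g else 1.

Lemma free_lift_endo (Q : groupType) (b : I -> Q) w :
  free_lift (endo_val b) w = free_lift b (phi w).
Proof. exact: free_lift_comp. Qed.

(** The set of relators is stable under [phi], which is why the proof by
    induction below is run for all evaluations at the same time: the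
    induction hypothesis is then also available for [b \o phi]. *)
Lemma kills_relators_endo (Q : groupType) (b : I -> Q) :
  kills_relators b -> kills_relators (endo_val b).
Proof. by move=> kb l r Rr; rewrite free_lift_endo -iterS kb. Qed.

(** All [phi]-iterates of the relators are commutators. This is how exponent
    sums, which are not preserved by sections, are controlled. *)
Lemma kills_relators_abelian (Q : groupType) (b : I -> Q) :
  (forall i j, commute (b i) (b j)) -> kills_relators b.
Proof.
move=> bC l _ /relator_is_commutator[x [y ->]].
by rewrite iter_kneading_endoR free_lift_commg_abelian.
Qed.

Lemma last_val_max (Q : groupType) (g : Q) : last_val g ord_max = g.
Proof. by rewrite /last_val eqxx. Qed.

Lemma commute_last_val (Q : groupType) (g : Q) (i j : I) :
  commute (last_val g i) (last_val g j).
Proof.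
rewrite /last_val; case: ifP => _; case: ifP => _ //;
  by [exact: commute1 | exact/commute_sym/commute1].
Qed.

Lemma endo_val_max (Q : groupType) (b : I -> Q) :
  endo_val b ord_max = b ord0 ^+ 2.
Proof.
by rewrite /endo_val /= /kneading_endo_gen unlift_none gmulfXn /= free_lift_gen.
Qed.

Lemma endo_val_lift (Q : groupType) (b : I -> Q) (j : 'I_m) :
  endo_val b (lift ord_max j) =
    if tnth v j then b (lift ord0 j) ^ (b ord0)^-1 else b (lift ord0 j).
Proof.
rewrite /endo_val /= /kneading_endo_gen liftK; case: ifP => _;
  last exact: free_lift_gen.
by rewrite !gmulfM gmulfV /= !free_lift_gen conjgE invgK mulgA.
Qed.

Section Consequences.
Variables (Q : groupType) (b : I -> Q).
Hypothesis kb : kills_relators b.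

Local Notation b0 := (b ord0).

Lemma relator_even (i j : 'I_m) k : (2 * k <= 2)%N -> tnth v i <> tnth v j ->
  commute (b (lift ord0 i)) (b (lift ord0 j) ^ (b0 ^+ (2 * k)%N)).
Proof.
move=> k2 vij; have := kb 0%N (or_introl (ex_intro _ i (ex_intro _ j
  (ex_intro2 _ _ k (conj k2 vij) erefl)))).
by rewrite /= gmulfR gmulfJ gmulfXn /= !free_lift_gen => /eqP/commgP.
Qed.

Lemma relator_odd (i j : 'I_m) : tnth v i = tnth v j ->
  commute (b (lift ord0 i)) (b (lift ord0 j) ^ b0).
Proof.
move=> vij; have := kb 0%N (or_intror (ex_intro _ i (ex_intro _ j
  (ex_intro2 _ _ 0%N (conj erefl vij) erefl)))).
by rewrite /= gmulfR gmulfJ gmulfXn /= !free_lift_gen expg1 => /eqP/commgP.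
Qed.

End Consequences.

Section Commutation.
Variables (Q : groupType) (b : I -> Q).
Hypothesis kb : kills_relators b.

Local Notation b0 := (b ord0).
Local Notation t := (b ord0 ^+ 2).
Local Notation L := (fun j : 'I_m => endo_val b (lift ord_max j)).

(** [L i] acts on the left half of the tree and [L j ^ b0] on the right half.
    Rewriting [L i] as a generator or its conjugate by [b0^-1], according to
    the letter of the word, the four cases are the relators of exponents [0],
    [1] and [2]. *)
Lemma commute_left_right i j : commute (L i) (L j ^ b0).
Proof.
rewrite /= !endo_val_lift.
case vi: (tnth v i); case vj: (tnth v j); rewrite ?conjgKV.
- apply/(commuteJ _ _ b0); rewrite conjgKV.
  by apply: (relator_odd kb); rewrite vi vj.
- apply/(commuteJ _ _ b0); rewrite conjgKV -conjgM.
  by apply: (relator_even kb (k := 1)); rewrite ?vi ?vj.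
- rewrite -[X in commute _ X]conjg1.
  by apply: (relator_even kb (k := 0)); rewrite ?vi ?vj.
- by apply: (relator_odd kb); rewrite vi vj.
Qed.

Let right_centralizer := [set x | forall j, commute x (L j ^ b0)].

(** Conjugating [commute_left_right] by [b0] gives the cases [z = 1] and
    [z = t] only; the other powers of [t] come from the images under [phi] of
    the relators that involve [a_n]. Put [p = phi a_1]. The relator between
    [a_n] and itself shows that [t] commutes with [t ^ p], which settles the
    case of [p]. If [L j = phi a_k] with [1 < k < n], the relators between
    [a_n] and [a_k] show that [t] commutes with [L j] or with [L j ^ p]; in
    the second case [L j ^ z] is a product of [L j], [p], [p ^ z] and their
    inverses. *)
Lemma left_conj_cyclic (j : 'I_m) z : generated_subgroup [set t] z ->
  right_centralizer (L j ^ z).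
Proof.
move=> tz; have sC : is_subgroup right_centralizer := centralizerP _.
have CL i : right_centralizer (L i).
  by move=> k; exact: commute_left_right.
have CLt i : right_centralizer (L i ^ t).
  move=> k; rewrite expg2 conjgM; apply/commuteJ/commute_sym.
  exact: commute_left_right.
have kc := kills_relators_endo kb.
have m_gt0 : 0 < m by apply: leq_ltn_trans (ltn_ord j).
case: (unliftP ord0 (ord_max : I)) => [i iE|/(congr1 val)/= m0]; last first.
  by exfalso; move: m_gt0; rewrite m0.
case: (unliftP ord_max (ord0 : I)) => [j0 j0E|/(congr1 val)/= m0]; last first.
  by exfalso; move: m_gt0; rewrite -m0.
have Cp u : generated_subgroup [set t] u -> right_centralizer (L j0 ^ u).
  apply: conj_cyclic => //.
  by have := relator_odd kc (erefl (tnth v i)); rewrite -iE -j0E endo_val_max.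
case: (unliftP ord0 (lift ord_max j)) => [j'|] jE; last first.
  have -> : j = j0 by apply: (@lift_inj _ ord_max); rewrite jE.
  exact: Cp.
have [vij|vij] := eqVneq (tnth v i) (tnth v j').
  have := relator_odd kc vij; rewrite -iE -jE j0E endo_val_max => tLp.
  apply: (conj_twisted sC (CL j) (CL j0) (Cp z tz)).
  exact/(commute_cyclic tz)/commute_sym.
have := relator_even kc (k := 0) erefl (elimN eqP vij).
rewrite -iE -jE {1}endo_val_max conjg1 => tL.
have -> // : L j ^ z = L j.
by apply/conjg_fixP/commgP/(commute_cyclic tz)/commute_sym.
Qed.

Local Notation c := (endo_val b).
Local Notation e := (last_val t).

(** The value of [phi u] corrected by a power of [t], so as to lie in the
    subgroup generated by the [L j ^ (t ^ k)], whose elements act on the left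
    half of the tree only. *)
Definition spread u := word_val c u * (word_val e u)^-1.

Lemma word_val_last_cyclic u : generated_subgroup [set t] (word_val e u).
Proof.
have sT := generated_subgroupP [set t].
have et i : generated_subgroup [set t] (e i).
  by rewrite /last_val; case: ifP => _; [move=> S [_]; exact | exact: sT.1].
apply: (subgroup_prod u (P := xpredT) (F := letter_val e) sT) => -[i []] _;
  rewrite /letter_val //=.
exact: (subgroupV sT).
Qed.

Lemma spread_nil : spread [::] = 1.
Proof. by rewrite /spread /word_val !big_nil mulgV. Qed.

Lemma spread_cons_max s u :
  spread ((ord_max, s) :: u) = spread u ^ (letter_val e (ord_max, s))^-1.
Proof.
rewrite /spread !word_val_cons.
have -> : letter_val c (ord_max, s) = letter_val e (ord_max, s).
  by rewrite /letter_val /= endo_val_max last_val_max.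
by rewrite conjgE invgK invgM !mulgA.
Qed.

Lemma spread_cons_lift (j : 'I_m) s u :
  spread ((lift ord_max j, s) :: u) =
  letter_val c (lift ord_max j, s) * spread u.
Proof.
rewrite /spread !word_val_cons.
have -> : letter_val e (lift ord_max j, s) = 1.
  by rewrite /letter_val /= /last_val lift_eqF invg1; case: s.
by rewrite mul1g mulgA.
Qed.

(** In the product [spread u], each letter [a_n] of [u] and its correcting
    factor conjugate the remaining letters by a power of [t]. *)
Lemma spread_subgroup (H : set Q) : is_subgroup H ->
    (forall (j : 'I_m) z, generated_subgroup [set t] z -> H (L j ^ z)) ->
  forall u z, generated_subgroup [set t] z -> H (spread u ^ z).
Proof.
move=> sH HL; elim=> [|[i s] u IHu] z tz.
  by rewrite spread_nil conj1g; exact: sH.1.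
have sT := generated_subgroupP [set t].
case: (unliftP ord_max i) => [j|] ->.
  rewrite spread_cons_lift conjMg; apply: subgroupM => //; last exact: IHu.
  case: s; rewrite /letter_val /=; last exact: HL.
  by rewrite conjVg; apply: subgroupV => //; exact: HL.
rewrite spread_cons_max -conjgM; apply: IHu; apply: (subgroupM sT) => //.
apply: (subgroupV sT); have := word_val_last_cyclic [:: (ord_max, s)].
by rewrite word_val_cons /word_val big_nil mulg1.
Qed.

(** Both factors are obtained from [left_conj_cyclic] by [spread_subgroup]: the
    first one applies it to the centralizer of the [L j ^ b0], the second one
    to the elements whose conjugate by [b0] centralizes every [spread u]. *)
Lemma commute_spread u u' : commute (spread u) (spread u' ^ b0).
Proof.
have sT := generated_subgroupP [set t].
have bz z : generated_subgroup [set t] z -> commute b0 z.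
  by move=> tz; apply: (commute_cyclic tz); apply: commuteX.
pose H := [set x | forall u : seq (letter I), commute (x ^ b0) (spread u)].
suff /(_ u' 1 sT.1 u) : forall u z, generated_subgroup [set t] z ->
    H (spread u ^ z).
  by rewrite conjg1 => /commute_sym.
apply: spread_subgroup.
  split=> [y|x y Hx Hy z]; first by rewrite conj1g; exact/commute_sym/commute1.
  rewrite conjMg conjVg; apply/commute_sym/commuteM/commuteV/commute_sym => //.
  exact/commute_sym.
move=> j z tz y; rewrite -conjgM -(bz _ tz) conjgM.
apply/(commuteJ _ _ z^-1); rewrite conjgK; apply/commute_sym.
apply: (spread_subgroup (centralizerP (fun j => L j ^ b0)) left_conj_cyclic).
exact: (subgroupV sT).
Qed.

(** The exponent sums of [a_n] in the two sections differ by the parity of the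
    number of letters [a_1] and [a_1^-1] in [w]: a letter [a_1] in front of
    [w] exchanges the two sections and adds a letter [a_n] to the second one.
    *)
Lemma last_val_sections w :
  word_val e (section v true w) =
  word_val e (section v false w) * t ^+ endpoint false w.
Proof.
have tE u : commute t (word_val e u).
  apply: commute_word_val => i.
  by rewrite /last_val; case: ifP => _ //; exact: commute1.
elim: w => [|[i s] w IHw] /=; first by rewrite mulg1.
rewrite /move /=; case: (unliftP ord0 i) => [j|] -> /=.
  rewrite /side_in liftK /shift_letter /= /shift liftK.
  case: (tnth v j); rewrite /= word_val_cons /letter_val /= /last_val lift_eqF;
  by rewrite ?invg1; case: s; rewrite mul1g IHw.
rewrite (endpointN false) /side_in unlift_none /shift_letter /= /shift.
rewrite unlift_none; case: s => /=; rewrite word_val_cons IHw /letter_val /=;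
  rewrite last_val_max; case: (endpoint false w);
  rewrite ?expg1 ?expg0 ?mulg1.
- by rewrite -tE mulKg.
- by rewrite -mulgA -tE mulKg.
- by rewrite tE.
- by rewrite tE.
Qed.

(** The normal form of the value of a word, in terms of its two sections. A
    letter [L j] multiplies the first factor, and a letter [L j ^ b0] moves
    past it by [commute_spread]; a letter [a_1] exchanges the two factors, up
    to the conjugations that match its action on the tree. *)
Lemma word_val_sections w :
  word_val b w =
  spread (section v false w) * spread (section v true w) ^ b0 *
  (word_val e (section v false w) * b0 ^+ endpoint false w).
Proof.
have bE u : commute b0 (word_val e u).
  apply: commute_word_val => i; rewrite /last_val.
  by case: ifP => _; [exact: commuteX | exact: commute1].
elim: w => [|[i s] w IHw].
  by rewrite /= spread_nil conj1g /word_val !big_nil !mulg1.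
rewrite word_val_cons /= /move /=.
case: (unliftP ord0 i) => [j|] -> /=.
  have letE : letter_val b (lift ord0 j, s) =
      letter_val c (lift ord_max j, s) ^ (if tnth v j then b0 else 1).
    rewrite /letter_val /= endo_val_lift; case: (tnth v j) => /=;
    by case: s; rewrite ?conjVg ?conjgKV ?conjg1.
  rewrite letE /side_in liftK /shift_letter /= /shift liftK IHw.
  case: (tnth v j) => /=; last first.
    rewrite spread_cons_lift conjg1 word_val_cons /letter_val /= /last_val.
    by rewrite lift_eqF invg1; case: s {letE}; rewrite mul1g !mulgA.
  have := commute_spread (section v false w) [:: (lift ord_max j, s)].
  rewrite !spread_cons_lift spread_nil mulg1 conjMg.
  move: (letter_val c _ ^ b0) (spread (section v false w)) => g x.
  by move: (_ ^ b0) => y xg; rewrite !mulgA xg.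
rewrite (endpointN false) /side_in unlift_none /shift_letter /= /shift.
rewrite unlift_none IHw.
have := last_val_sections w; have := commute_spread.
have := bE (section v false w).
move: (section v false w) (section v true w) => u0 u1.
move: (endpoint false w) => o bE0 spC E1.
have E0 n : b0 ^+ n * word_val e u0 = word_val e u0 * b0 ^+ n.
  exact/commute_sym/commuteX/commute_sym.
case: s => /=; rewrite spread_cons_max ?word_val_cons /letter_val /=
  last_val_max.
  rewrite invgK E1 mulVg_conj; congr (_ * _).
    by rewrite expg2 conjgM; apply/commuteJ; exact: spC.
  case: o {E1} => /=; rewrite ?mulg1 ?expg0 ?expg1.
    by rewrite -bE0 mulKg -E0 mulKg.
  by rewrite -mulgA -bE0 expg2 invgM -mulgA !mulKg.
rewrite E1 mulg_conj; congr (_ * _).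
  have -> : (spread u0 ^ t^-1) ^ b0 = spread u0 ^ b0^-1.
    by rewrite -conjgM expg2 invgM mulgVK.
  by apply/(commuteJ _ _ b0); rewrite conjgKV; exact: spC.
rewrite mulgA bE0 -!mulgA; congr (_ * _).
by case: o {E1}; rewrite /= ?expg0 ?expg1 ?mulg1 ?mul1g.
Qed.

End Commutation.

End Relations.

(** * The relators act trivially on the tree *)

Section TreeAction.
Variables (m : nat) (v : m.-tuple bool).
Local Notation I := ('I_m.+1).
Local Notation a := (kneading_gen v).

Definition side_aut (x : bool) (g : tree_aut) : tree_aut :=
  if x then pair_aut 1 g else pair_aut g 1.

Lemma pair_autM g0 g1 h0 h1 :
  pair_aut (g0 * h0) (g1 * h1) = pair_aut g0 g1 * pair_aut h0 h1.
Proof. by apply: tree_autP => -[|[] u]. Qed.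

Lemma pair_aut1 : pair_aut 1 1 = 1.
Proof. by apply: tree_autP => -[|[] u]. Qed.

Lemma pair_autV g0 g1 : pair_aut g0^-1 g1^-1 = (pair_aut g0 g1)^-1.
Proof. by apply/esym/mulg1_eq; rewrite -pair_autM !mulgV pair_aut1. Qed.

Lemma commute_side_aut x g h : commute (side_aut x g) (side_aut (~~ x) h).
Proof. by case: x; rewrite /commute /= -!pair_autM !mul1g !mulg1. Qed.

(** Conjugation by [a_1] exchanges the two halves of the tree. *)
Lemma side_aut0J g : side_aut false g ^ a ord0 = side_aut true g.
Proof.
apply: (mulgI (a ord0)); rewrite -conjgC (kneading_genP v).1 /=.
by apply: tree_autP => -[|[] u].
Qed.

Lemma side_aut1J g :
  side_aut true g ^ a ord0 = side_aut false (g ^ a ord_max).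
Proof.
apply: (mulgI (a ord0)); rewrite -conjgC (kneading_genP v).1 conjgE /=.
by apply: tree_autP => -[|[] u] //=; rewrite kneading_funK.
Qed.

Lemma side_autJ x g n :
  exists h, side_aut x g ^ (a ord0 ^+ n) = side_aut (x (+) odd n) h.
Proof.
elim: n => [|n [h IHn]]; first by exists g; rewrite addbF conjg1.
rewrite expgSr conjgM IHn /= addbN.
case: (x (+) odd n); first by exists (h ^ a ord_max); exact: side_aut1J.
by exists h; exact: side_aut0J.
Qed.

Lemma kneading_gen_lift (j : 'I_m) :
  a (lift ord0 j) = side_aut (tnth v j) (a (lift ord_max j)).
Proof. exact: (kneading_genP v).2. Qed.

(** In each relator the parity of the exponent of [a_1] is the one for which
    the two commuting elements are supported on different halves. *)
Lemma relator_trivial r : kneading_relators v r -> free_lift a r = 1.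
Proof.
suff E (i j : 'I_m) n : tnth v j (+) odd n = ~~ tnth v i ->
    free_lift a [~ free_gen (lift ord0 i),
                   free_gen (lift ord0 j) ^ (free_gen ord0 ^+ n)] = 1.
  case=> -[i [j [k [_ vij] ->]]]; apply: E.
    by move: vij; rewrite mul2n odd_double; case: (tnth v i); case: (tnth v j).
  by rewrite addn1 mul2n /= odd_double addbT vij.
move=> vij; rewrite gmulfR gmulfJ gmulfXn /= !free_lift_gen !kneading_gen_lift.
have [h ->] := side_autJ (tnth v j) (a (lift ord_max j)) n.
by rewrite vij; apply/eqP/commgP; exact: commute_side_aut.
Qed.

(** This is [psi (phi w) = (w, a_n ^ k)], with [k] the exponent sum of [a_n]. *)
Lemma free_lift_endo_gen w :
  free_lift a (kneading_endo v w) =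
  pair_aut (free_lift a w) (free_lift (last_val (a ord_max)) w).
Proof.
rewrite -free_lift_endo /free_lift; elim: (free_word w) => [|[i s] u IHu].
  by rewrite !big_nil pair_aut1.
rewrite !big_cons IHu pair_autM; congr (_ * _).
suff E : endo_val v a i = pair_aut (a i) (last_val (a ord_max) i).
  by case: s; rewrite /letter_val /= E ?pair_autV.
case: (unliftP ord_max i) => [j|] ->; last first.
  rewrite endo_val_max last_val_max expg2 (kneading_genP v).1.
  by apply: tree_autP => -[|[] x].
rewrite endo_val_lift /last_val lift_eqF kneading_gen_lift.
by case: (tnth v j); rewrite // -[side_aut true _]side_aut0J conjgK.
Qed.

Lemma kills_relators_gen : kills_relators v a.
Proof.
move=> l r Rr; elim: l => [|l IHl]; first exact: relator_trivial.
rewrite iterS free_lift_endo_gen IHl.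
by rewrite (kills_relators_abelian (commute_last_val (a ord_max))) ?pair_aut1.
Qed.

End TreeAction.

(** * The presentation *)

Section Faithful.
Variables (m : nat) (v : m.-tuple bool) (Q : groupType).
Local Notation I := ('I_m.+1).
Local Notation a := (kneading_gen v).
Implicit Types w : seq (letter I).

(** The quantification over [b] makes this stable under [phi]: besides [b],
    the proof evaluates sections at [b \o phi] and at an abelian tuple. *)
Definition is_consequence w : Prop :=
  forall b : I -> Q, kills_relators v b -> word_val b w = 1.

Lemma is_consequence_sections w : endpoint false w = false ->
    (forall x, is_consequence (section v x w)) -> is_consequence w.
Proof.
move=> w0 sw b kb; rewrite (word_val_sections kb) w0 mulg1 /spread.
have e1 x : word_val (last_val (b ord0 ^+ 2)) (section v x w) = 1.
  by apply: sw; apply: kills_relators_abelian; exact: commute_last_val.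
have c1 x : word_val (endo_val v b) (section v x w) = 1.
  by apply: sw; exact: kills_relators_endo.
by rewrite !c1 !e1 mulgV conj1g !mulg1.
Qed.

(** A counterexample [w] of minimal size has a section of full size which is
    again a counterexample, and this repeats at all levels, so that [w] is a
    closed walk. A backtrack in [w] can be deleted, against minimality. *)
Lemma trivial_is_consequence w : word_val a w = 1 -> is_consequence w.
Proof.
have [n le_n] := ubnP (size w); elim: n => // n IHn in w le_n *.
move=> w1; apply: contrapT => nw.
have step u : size u = size w -> word_val a u = 1 -> ~ is_consequence u ->
    (exists x, walk v x u x) /\
    [/\ word_val a (map shift_letter u) = 1 &
        ~ is_consequence (map shift_letter u)].
  move=> uw u1 nu; have [x nx] : exists x, ~ is_consequence (section v x u).
    apply/existsNP => cu; apply: nu; apply: is_consequence_sections => //.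
    by have [] := act_trivial false u1.
  have [ux sx1] := act_trivial x u1.
  have sx : size (section v x u) = size u.
    apply/eqP; rewrite eqn_leq size_section /= leqNgt; apply/negP => lt_u.
    apply/nx/IHn => //; apply: leq_trans lt_u _.
    by rewrite uw -ltnS.
  have [ww sE] := section_full sx; rewrite ux in ww; rewrite -sE.
  by split; [exists x | split].
have iter_step k : [/\ word_val a (map (iter k shift_letter) w) = 1 &
    ~ is_consequence (map (iter k shift_letter) w)].
  elim: k => [|k [k1 nk]]; first by rewrite map_id.
  have [_] := step _ (size_map _ _) k1 nk.
  by rewrite -map_comp.
have w_neq0 : w != [::].
  by apply/eqP => w0; apply: nw => b _; rewrite w0 /word_val big_nil.
have [k|w2 [c [w3 wE]]] := @closed_walk_backtracks _ v w w_neq0.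
  by have [k1 nk] := iter_step k; have [] := step _ (size_map _ _) k1 nk.
have red (G : groupType) (b : I -> G) : word_val b w = word_val b (w2 ++ w3).
  by rewrite wE !word_val_cat !word_val_cons letter_val_linv mulVKg.
apply: nw => b kb; rewrite red; apply: IHn kb; last by rewrite -red.
by rewrite -ltnS; apply: leq_trans le_n; rewrite wE !size_cat /= !addnS !ltnS.
Qed.

End Faithful.

Theorem theorem3p8 (m : nat) (v : m.-tuple bool) :
  has_presentation (kneading_group v) (kneading_gen v)
    [set w | exists l : nat, exists2 r,
       kneading_relators v r & w = iter l (kneading_endo v) r].
Proof.
split; apply/seteqP; split.
- move=> _ [w _ <-]; have sK := generated_subgroupP (range (kneading_gen v)).
  apply: (subgroup_prod w (P := xpredT) (F := letter_val (kneading_gen v)) sK).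
  have Kgen i : kneading_group v (kneading_gen v i).
    by move=> H [_]; apply; exists i.
  case=> i [] _; rewrite /letter_val /=; last exact: Kgen.
  exact: (subgroupV sK (Kgen i)).
- move=> g; apply; split=> [|_ [i _ <-]].
    split; first by exists 1; rewrite // gmulf1.
    by move=> _ _ [x _ <-] [y _ <-]; exists (x * y^-1); rewrite // gmulfF.
  by exists (free_gen i); rewrite // free_lift_gen.
- move=> w /= w1; set R := [set w | _]; set nN := normal_closureP R.
  pose b i := quotient_pi nN (free_gen i).
  have bE u : free_lift b u = quotient_pi nN u.
    by rewrite -[in RHS](free_lift_id u) -free_lift_comp.
  apply/(quotient_pi_eq1 nN); rewrite -bE.
  apply: (trivial_is_consequence w1) => l r Rr; rewrite bE.
  by apply/quotient_pi_eq1 => H [_]; apply; exists l, r.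
- move=> w Nw; apply: (Nw [set w | free_lift (kneading_gen v) w = 1]); split.
    split; first split=> [|x y /= x1 y1]; first exact: gmulf1.
      by rewrite gmulfF /= x1 y1 divg1.
    by move=> x y /= x1; rewrite gmulfJ /= x1 conj1g.
  by move=> _ [l [r Rr ->]]; exact: kills_relators_gen.
Qed.
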